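(* Let $0<a<T$ and let $B$ be a one-dimensional Wiener process on $[0,T]$. For any $x\in\mathbb R$, the functional $$\xi(x)=\int_a^T\delta(x-B_s)\,dB_s$$ belongs to the Sobolev-Watanabe space $\mathbb D^{-\alpha,2}$ for any $\alpha>\frac12$.
   Context: $I_n$ is the multiple Wiener-Itô integral of order $n$ with respect to $B$, with $\mathbf E[I_n(f)I_n(g)]=n!\langle f,g\rangle_{L^2([0,T]^n)}$ for symmetric $f,g$. $\delta$ is the Dirac delta, understood as a generalized random variable through the chaos expansion $\delta(x-B_s)=\sum_{n\ge0}a^x_n(s)I_n(1_{[0,s]}^{\otimes n})$, where $a^x_n(s)=s^{-n/2}p_s(x)H_n(x/\sqrt s)$, $p_s(x)=\frac1{\sqrt{2\pi s}}e^{-x^2/(2s)}$, and $H_n(x)=\frac{(-1)^n}{n!}e^{x^2/2}\frac{d^n}{dx^n}e^{-x^2/2}$. The integral is the divergence (Skorohod) integral, which on chaos expansions gives $$\xi(x)=\sum_{n\ge0}I_{n+1}\left(\big(a^x_n(s)1_{[0,s]}^{\otimes n}(\cdot)1_{[a,T]}(s)\big)^\sim\right),$$ where $(\cdot)^\sim$ denotes symmetrization in the $n+1$ variables $(s,t_1,\dots,t_n)$. For $\beta\in\mathbb R$, a formal sum $F=\sum_{n\ge0}I_n(f_n)$ with symmetric $f_n\in L^2([0,T]^n)$ belongs to $\mathbb D^{\beta,2}$ if and only if $\sum_{n\ge0}(1+n)^\beta\,n!\,\|f_n\|^2_{L^2([0,T]^n)}<\infty$. *)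

(* Defs.v *)
From HB Require Import structures.
From mathcomp Require Import all_boot all_order all_algebra perm.
From mathcomp Require Import all_classical all_reals all_analysis.

Set Implicit Arguments.
Unset Strict Implicit.
Unset Printing Implicit Defensive.

Import Order.TTheory GRing.Theory Num.Theory.
Import numFieldNormedType.Exports.

Local Open Scope classical_set_scope.
Local Open Scope ring_scope.

Section tuple_measure.
Context (d : measure_display) (X : measurableType d) (R : realType).

Definition tcons n (z : X * n.-tuple X) : n.+1.-tuple X := [tuple of z.1 :: z.2].

Lemma measurable_tcons n : measurable_fun [set: X * n.-tuple X] (@tcons n).
Proof. exact: measurable_cons. Qed.

Section step.
Variables (m : {finite_measure set X -> \bar R}) (n : nat).
Variable mun : {finite_measure set (n.-tuple X) -> \bar R}.

Definition tuple_measureS : set (n.+1.-tuple X) -> \bar R :=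
  pushforward (m \x mun)%E (@tcons n).

Let tuple_measureS0 : tuple_measureS set0 = 0%E.
Proof. by rewrite /tuple_measureS /pushforward preimage_set0 measure0. Qed.

Let mpre A : measurable A -> measurable (@tcons n @^-1` A).
Proof.
by move=> mA; rewrite -[X in measurable X]setTI; exact: measurable_tcons.
Qed.

Let tuple_measureS_ge0 A : (0 <= tuple_measureS A)%E.
Proof. by rewrite /tuple_measureS /pushforward measure_ge0. Qed.

Let tuple_measureS_sigma_additive : semi_sigma_additive tuple_measureS.
Proof.
move=> F mF tF mUF; rewrite /tuple_measureS /pushforward preimage_bigcup.
apply: measure_semi_sigma_additive.
- by move=> i; exact: mpre.
- apply/trivIsetP => /= i j _ _ ij; rewrite -preimage_setI.
  by move/trivIsetP : tF => /(_ _ _ _ _ ij) ->//; rewrite preimage_set0.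
- by rewrite -preimage_bigcup; exact: mpre.
Qed.

HB.instance Definition _ := isMeasure.Build _ _ _ tuple_measureS
  tuple_measureS0 tuple_measureS_ge0 tuple_measureS_sigma_additive.

Let tuple_measureS_fin : fin_num_fun tuple_measureS.
Proof.
move=> A mA; rewrite ge0_fin_numE ?measure_ge0//.
apply: (@le_lt_trans _ _ ((m \x mun)%E (setT `*` setT))).
  rewrite setXTT /= /tuple_measureS /pushforward.
  by apply: le_measure; rewrite ?inE//; exact: mpre.
rewrite product_measure1E//.
by rewrite -ge0_fin_numE ?mule_ge0// fin_numM// fin_num_measure.
Qed.

HB.instance Definition _ := Measure_isFinite.Build _ _ _ tuple_measureS
  tuple_measureS_fin.

End step.

(* The [n]-fold product of [m]; the step transports [m \x tuple_measure m n]
   along [tcons]. *)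
Fixpoint tuple_measure (m : {finite_measure set X -> \bar R}) n :
    {finite_measure set (n.-tuple X) -> \bar R} :=
  match n with
  | 0 => dirac [tuple]
  | n'.+1 => tuple_measureS m (tuple_measure m n')
  end.

End tuple_measure.

Section interval_measure.
Context (R : realType) (T : R).

Definition itv_measure : set (measurableTypeR R) -> \bar R :=
  mrestr (@lebesgue_measure R) (measurable_itv `[0, T]).

HB.instance Definition _ := Measure.on itv_measure.

Let itv_measure_fin : fin_num_fun itv_measure.
Proof.
move=> A mA; rewrite ge0_fin_numE ?measure_ge0//.
apply: (@le_lt_trans _ _ (@lebesgue_measure R `[0, T])).
  apply: le_measure; rewrite ?inE//.
  by apply: measurableI => //; exact: measurable_itv.
by rewrite lebesgue_measure_itv/=; case: ifP => _; rewrite -?EFinB ltry.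
Qed.

HB.instance Definition _ := Measure_isFinite.Build _ _ _ itv_measure
  itv_measure_fin.

End interval_measure.

Definition cube_measure (R : realType) (T : R) (n : nat) :
    {finite_measure set (n.-tuple (measurableTypeR R)) -> \bar R} :=
  tuple_measure (itv_measure T) n.

Section wiener_chaos.
Context (R : realType) (d : measure_display) (Omega : measurableType d).
Variables (P : probability Omega R) (T : R).

Record wiener_process (B : R -> Omega -> R) : Prop := {
  wiener_measurable : forall t : R, 0 <= t <= T -> measurable_fun setT (B t) ;
  wiener0 : {ae P, forall w, B 0 w = 0} ;
  wiener_gaussian : forall s t : R, 0 <= s -> s < t -> t <= T ->
    forall A : set R, measurable A ->
      P ((fun w => B t w - B s w) @^-1` A) =
      normal_prob 0 (Num.sqrt (t - s)) A ;
  wiener_independent : forall (k : nat) (t : nat -> R) (A : nat -> set R),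
    0 <= t 0%N -> (forall i, (i < k)%N -> t i <= t i.+1) -> t k <= T ->
    (forall i, measurable (A i)) ->
    P (\bigcap_(i in `I_k) ((fun w => B (t i.+1) w - B (t i) w) @^-1` A i)) =
    (\prod_(i < k) P ((fun w => B (t i.+1) w - B (t i) w)%R @^-1` A i))%E ;
  wiener_continuous :
    {ae P, forall w, {within `[0, T], continuous (fun t => B t w)}} }.

Definition chaos_kernel n := n.-tuple (measurableTypeR R) -> R.

Definition perm_tuple n (s : 'S_n) (t : n.-tuple (measurableTypeR R)) :
    n.-tuple (measurableTypeR R) :=
  [tuple tnth t (s i) | i < n].

Definition symmetric_kernel n (f : chaos_kernel n) : Prop :=
  forall (s : 'S_n) t, f (perm_tuple s t) = f t.

Definition symmetrize n (f : chaos_kernel n) : chaos_kernel n :=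
  fun t => n`!%:R^-1 * \sum_(s : 'S_n) f (perm_tuple s t).

Definition L2_kernel n (f : chaos_kernel n) : Prop :=
  f \in Lfun (cube_measure T n) 2%:E.

(* These properties determine [I n f] up to a [P]-null set, because the
   products of indicators of pairwise disjoint intervals span a dense subspace
   of L^2([0,T]^n). *)
Record multiple_wiener_integral (B : R -> Omega -> R)
    (I : forall n, chaos_kernel n -> Omega -> R) : Prop := {
  mwi_L2 : forall n (f : chaos_kernel n), L2_kernel f -> I n f \in Lfun P 2%:E ;
  mwi_linear : forall n (c : R) (f g : chaos_kernel n), L2_kernel f -> L2_kernel g ->
    {ae P, forall w, I n (fun t => c * f t + g t) w = c * I n f w + I n g w} ;
  mwi_symmetrize : forall n (f : chaos_kernel n), L2_kernel f ->
    {ae P, forall w, I n f w = I n (symmetrize f) w} ;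
  mwi_isometry : forall n (f g : chaos_kernel n), L2_kernel f -> L2_kernel g ->
    symmetric_kernel f -> symmetric_kernel g ->
    ('E_P[(I n f \* I n g)%R] =
     n`!%:R%:E * \int[cube_measure T n]_t (f t * g t)%R%:E)%E ;
  mwi_step : forall n (u v : 'I_n -> R),
    (forall i, 0 <= u i) -> (forall i, u i <= v i) -> (forall i, v i <= T) ->
    trivIset setT (fun i => `]u i, v i]%classic) ->
    {ae P, forall w,
      I n (fun t => \prod_(i < n) \1_(`]u i, v i]%classic) (tnth t i)) w =
      \prod_(i < n) (B (v i) w - B (u i) w)} }.

Variable I : forall n, chaos_kernel n -> Omega -> R.

(* A generalized functional is a formal sum of random variables, represented by
   the sequence of its summands; no convergence is required. *)
Definition formal_functional := nat -> Omega -> R.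

Definition chaos_series (f : forall n, chaos_kernel n) : formal_functional :=
  fun n => I (f n).

Definition watanabe_sobolev (beta : R) (F : formal_functional) : Prop :=
  exists f : forall n, chaos_kernel n,
    [/\ forall n, L2_kernel (f n),
        forall n, symmetric_kernel (f n),
        forall n, {ae P, forall w, F n w = chaos_series f n w} &
        (\sum_(0 <= n <oo) ((1 + n%:R) `^ beta * n`!%:R)%R%:E *
           'N[cube_measure T n]_2%:E[EFin \o f n] ^+ 2 < +oo)%E].

Definition divergence_kernel (u : R -> forall n, chaos_kernel n) (n : nat) :
    chaos_kernel n :=
  match n with
  | 0 => fun=> 0
  | n'.+1 => symmetrize (fun t => u (thead t) n' [tuple of behead t])
  end.

(* [skorohod u] is the divergence of the process whose value at time [s] is
   [chaos_series (u s)]; in its kernels [s] is the first coordinate before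
   symmetrization. *)
Definition skorohod (u : R -> forall n, chaos_kernel n) : formal_functional :=
  chaos_series (divergence_kernel u).

End wiener_chaos.

Section donsker_delta.
Context (R : realType).

Definition heat_kernel (s x : R) : R :=
  (Num.sqrt (2 * pi * s))^-1 * expR (- (x ^+ 2 / (2 * s))).

(* Normalised by [n`!], as [He_n / n`!] for the probabilists' [He_n]. *)
Definition hermite (n : nat) (x : R) : R :=
  (-1) ^+ n / n`!%:R * expR (x ^+ 2 / 2) *
  derive1n n (fun y : R => expR (- (y ^+ 2 / 2))) x.

Definition donsker_coef (x : R) (n : nat) (s : R) : R :=
  s `^ (- (n%:R / 2)) * heat_kernel s x * hermite n (x / Num.sqrt s).

(* Kernels of [delta(x - B_s)], meaningful for [0 < s]. *)
Definition donsker_kernel (x s : R) (n : nat) : chaos_kernel R n :=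
  fun t => donsker_coef x n s * \prod_(i < n) \1_(`[0, s]%classic) (tnth t i).

Definition donsker_integral (a T x : R) (d : measure_display)
    (Omega : measurableType d) (I : forall n, chaos_kernel R n -> Omega -> R) :
    formal_functional R Omega :=
  skorohod I (fun s n t => \1_(`[a, T]%classic) s * donsker_kernel x s t).

End donsker_delta.

(* Main.v *)
Require Import Defs.
From HB Require Import structures.
From mathcomp Require Import all_boot all_order all_algebra perm fingroup.
From mathcomp Require Import all_classical all_reals all_analysis.
From mathcomp Require Import measurable_realfun zify ring lra.

Import Order.TTheory GRing.Theory Num.Theory.
Import numFieldNormedType.Exports.

Local Open Scope classical_set_scope.
Local Open Scope ring_scope.

(* Almost everywhere, the symmetrized kernel of order n+1 at t equals
   (n+1)^-1 a_n(max t) 1_[a,T](max t), so its squared norm is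
   (n+1)^-1 \int_a^T s^n a_n(s)^2 ds.  With g(y) = exp(-y^2/2),
   s^n a_n(s)^2 = g^(n)(x/sqrt s)^2 / (2 pi s n!^2), and
   g^(n)(y)^2 <= 2 n! / sqrt(n+1) for all y: by the differential equation
   g^(n+2) = - y g^(n+1) - (n+1) g^(n), the energy
   (n+1) (g^(n))^2 + (g^(n+1))^2 is maximal at y = 0, where it is explicit.
   The n-th term of the Sobolev series is therefore O(n^(-alpha-1/2)). *)

(** * Derivatives of the Gaussian and their uniform bound *)

Definition gauss {R : realType} (y : R) : R := expR (- (y ^+ 2 / 2)).

Lemma is_derive_gauss (R : realType) (y : R) :
  is_derive y 1 (@gauss R) (- (y * gauss y)).
Proof.
pose q := fun z : R => - ((2^-1 : R) *: z ^+ 2).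
have -> : @gauss R = expR \o q.
  by apply/funext => z; rewrite /gauss /q /= [_ *: _]mulrC.
have dq : is_derive y 1 q (- y).
  have h := is_deriveN
    (is_deriveZ 2^-1 (is_deriveX 2 (is_derive_id y (1 : R)))).
  by apply: (is_derive_eq h); rewrite /GRing.scale /=; field.
apply: (is_derive_eq (is_derive1_comp (is_derive_expR (q y)) dq)).
by rewrite mulrN mulrC; congr (- (_ * expR (- _))); rewrite mulrC.
Qed.

(** By the Rodrigues formula this is (-1)^n He_n(y) exp(-y^2/2), with He_n the probabilists' Hermite
    polynomial. *)
Definition gaussn {R : realType} (n : nat) : R -> R := derive1n n (@gauss R).

Arguments gaussn : simpl never.

(** Differentiating the recurrence at n yields the one at n+1, and this requires differentiability
    at two consecutive orders; hence a single induction carries all three claims. *)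
Lemma gaussn_rec (R : realType) (n : nat) :
  [/\ forall y : R, is_derive y 1 (gaussn n) (gaussn n.+1 y),
      forall y : R, is_derive y 1 (gaussn n.+1) (gaussn n.+2 y) &
      forall y : R, gaussn n.+2 y =
        - (y * gaussn n.+1 y + n.+1%:R * gaussn n y)].
Proof.
elim: n => [|n [dn dn1 rec]].
  have E1 : @gaussn R 1 = fun y => - (y * gauss y).
    apply/funext => y; rewrite /gaussn derive1n1 derive1E.
    by apply: derive_val; exact: (is_derive_gauss R).
  have d1 (y : R) : is_derive y 1 (@gaussn R 1)
      (- (y * - (y * gauss y) + gauss y)).
    rewrite E1; pose proof (is_derive_gauss R y).
    by apply: is_derive_eq; rewrite /GRing.scale /= mulr1.
  have E2 y : @gaussn R 2 y = - (y * - (y * gauss y) + gauss y).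
    by rewrite /gaussn derive1nS derive1E; apply: derive_val; exact: d1.
  split=> y; first by rewrite E1; exact: (is_derive_gauss R).
    by rewrite E2; exact: d1.
  by rewrite E2 E1 mul1r.
have Er : @gaussn R n.+2 = fun y =>
    - (y * gaussn n.+1 y + n.+1%:R *: gaussn n y).
  by apply/funext => y; rewrite rec.
have d2 (y : R) : is_derive y 1 (gaussn n.+2)
   (- (y * gaussn n.+2 y + n.+2%:R * gaussn n.+1 y)).
  have h1 := dn1 y; have h := dn y.
  rewrite Er; apply: is_derive_eq.
  rewrite rec /GRing.scale /= -(@natr1 R n.+1); ring.
have E3 y : @gaussn R n.+3 y = - (y * gaussn n.+2 y + n.+2%:R * gaussn n.+1 y).
  by rewrite {1}/gaussn derive1nS derive1E; apply: derive_val; exact: d2.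
split; [exact: dn1 | by move=> y; rewrite E3; exact: d2 | exact: E3].
Qed.

Lemma is_derive_gaussn (R : realType) (n : nat) (y : R) :
  is_derive y 1 (gaussn n) (gaussn n.+1 y).
Proof. by have [] := gaussn_rec R n. Qed.

Lemma gaussnSS (R : realType) (n : nat) (y : R) :
  gaussn n.+2 y = - (y * gaussn n.+1 y + n.+1%:R * gaussn n y).
Proof. by have [] := gaussn_rec R n. Qed.

Lemma continuous_gaussn (R : realType) (n : nat) : continuous (@gaussn R n).
Proof.
move=> y; apply/differentiable_continuous/derivable1_diffP.
by have [] := is_derive_gaussn R n y.
Qed.

Lemma gaussn_energy (R : realType) (n : nat) (y : R) :
  n.+1%:R * (gaussn n y) ^+ 2 + (gaussn n.+1 y) ^+ 2 <=
  n.+1%:R * (gaussn n 0) ^+ 2 + (gaussn n.+1 0) ^+ 2 :> R.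
Proof.
(* By the recurrence, the cross terms of V' cancel. *)
pose V := fun y : R => n.+1%:R *: (gaussn n y) ^+ 2 + (gaussn n.+1 y) ^+ 2.
pose dV := fun z : R => - (2 * z) * (gaussn n.+1 z) ^+ 2.
have dVP (z : R) : is_derive z 1 V (dV z).
  have h1 := is_derive_gaussn R n z; have h := is_derive_gaussn R n.+1 z.
  have D := is_deriveD (is_deriveZ n.+1%:R (is_deriveX 2 h1)) (is_deriveX 2 h).
  apply: (is_derive_eq D).
  rewrite gaussnSS /dV /GRing.scale /= !expr1; ring.
have cV (A : set R) : {within A, continuous V}.
  apply: continuous_subspaceT => z.
  by apply/differentiable_continuous/derivable1_diffP; have [] := dVP z.
suff : V y <= V 0 by [].
(* V'(z) = -2 z g^(n+1)(z)^2 is nonpositive for z >= 0 and nonnegative for z <= 0, so the mean value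
   theorem between 0 and y gives V(y) <= V(0) on either side. *)
have [y0|/ltW y0] := leP 0 y.
- have [c + E] := MVT_segment y0 (fun x _ => dVP x) (cV _).
  rewrite in_itv /= => /andP[c0 _].
  rewrite -subr_le0 E subr0 /dV !mulNr oppr_le0; apply: mulr_ge0 => //.
  by apply: mulr_ge0; rewrite ?sqr_ge0 // mulr_ge0.
- have [c + E] := MVT_segment y0 (fun x _ => dVP x) (cV _).
  rewrite in_itv /= => /andP[_ c0].
  rewrite -subr_ge0 E /dV sub0r; apply: mulr_ge0; last by rewrite oppr_ge0.
  by apply: mulr_ge0; rewrite ?sqr_ge0 // oppr_ge0 mulr_ge0_le0.
Qed.

(** At 0 the recurrence reads g^(n+2)(0) = -(n+1) g^(n)(0). The induction therefore advances by two,
    which is why a pair of consecutive bounds is proved, and its step reduces to sqrt((n+1)(n+3)) <=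
    n+2. *)
Lemma gaussn0_le (R : realType) (n : nat) :
  (gaussn n 0) ^+ 2 <= n`!%:R / Num.sqrt n.+1%:R :> R.
Proof.
have [] : (gaussn n 0) ^+ 2 <= n`!%:R / Num.sqrt n.+1%:R :> R /\
  (gaussn n.+1 0) ^+ 2 <= n.+1`!%:R / Num.sqrt n.+2%:R :> R; last by [].
elim: n => [|n [IH0 IH1]].
  have -> : gaussn 0 0 = 1 :> R.
    by rewrite /gaussn derive1n0 /gauss expr0n /= mul0r oppr0 expR0.
  have -> : gaussn 1 0 = 0 :> R.
    rewrite /gaussn derive1n1 derive1E.
    rewrite (@derive_val _ _ _ _ _ _ _ (is_derive_gauss R 0)).
    by rewrite mul0r oppr0.
  by rewrite expr1n sqrtr1 divr1 expr0n /= divr_ge0 ?sqrtr_ge0.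
split=> //.
rewrite gaussnSS mul0r add0r sqrrN exprMn.
have s1 : 0 < Num.sqrt n.+1%:R :> R by rewrite sqrtr_gt0.
have s3 : 0 < Num.sqrt n.+3%:R :> R by rewrite sqrtr_gt0.
apply: (le_trans (ler_wpM2l (sqr_ge0 _) IH0)).
rewrite !factS !natrM [leLHS]mulrA ler_pdivrMr // [leRHS]mulrAC ler_pdivlMr //.
have h : Num.sqrt (n.+1%:R) * Num.sqrt n.+3%:R <= n.+2%:R :> R.
  rewrite -sqrtrM // -[leRHS]ger0_norm // -sqrtr_sqr ler_wsqrtr //.
  by rewrite -natrM -natrX ler_nat; lia.
have E := sqr_sqrtr (ler0n R n.+1).
have := ler_wpM2l (ltW s1) h; rewrite /= => {}h.
have {}h : n.+1%:R * Num.sqrt n.+3%:R <= Num.sqrt n.+1%:R * n.+2%:R :> R.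
  by rewrite -[X in X * _ <= _]E expr2 -mulrA.
have f0 : 0 <= n.+1%:R * n`!%:R :> R by rewrite mulr_ge0.
have := ler_wpM2l f0 h; congr (_ <= _); ring.
Qed.

(** The energy at y dominates (n+1) g^(n)(y)^2, and each of the two terms of the energy at 0 is at
    most (n+1)!/sqrt(n+1); hence the factor 2. *)
Lemma gaussn_le (R : realType) (n : nat) (y : R) :
  (gaussn n y) ^+ 2 <= n`!%:R * 2 / Num.sqrt n.+1%:R :> R.
Proof.
have n0 : 0 < n.+1%:R :> R by [].
rewrite -(ler_pM2l n0).
apply: le_trans (_ : n.+1%:R * gaussn n y ^+ 2 + gaussn n.+1 y ^+ 2 <= _).
  by rewrite lerDl sqr_ge0.
apply: (le_trans (gaussn_energy R n y)).
have h0 := ler_wpM2l (ltW n0) (gaussn0_le R n).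
have h1 := gaussn0_le R n.+1.
apply: (le_trans (lerD h0 h1)).
have s1 : 0 < Num.sqrt n.+1%:R :> R by rewrite sqrtr_gt0.
have h2 : (Num.sqrt n.+2%:R)^-1 <= (Num.sqrt n.+1%:R)^-1 :> R.
  by rewrite lef_pV2 ?posrE ?sqrtr_gt0 // ler_wsqrtr // ler_nat.
have f0 : 0 <= n.+1%:R * n`!%:R :> R by rewrite mulr_ge0.
have := ler_wpM2l f0 h2; rewrite factS natrM; lra.
Qed.

(** * Convergence of the series of (n+1)^(-p) for p > 1 *)

(** With z = y+1, the bounds ln(1+u) <= u at u = -1/z and exp(u) >= 1+u give 1 + q/z <= (z/y)^q; the
    claim is this inequality divided by z^q. It replaces an integral comparison. *)
Lemma powR_telescope_le (R : realType) (q y : R) : 0 < q -> 0 < y ->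
  q * ((y + 1) `^ (1 + q))^-1 <= (y `^ q)^-1 - ((y + 1) `^ q)^-1.
Proof.
move=> q0 y0; set z := y + 1.
have z0 : 0 < z by rewrite addr_gt0.
have yq : 0 < y `^ q by rewrite powR_gt0.
have zq : 0 < z `^ q by rewrite powR_gt0.
have ln_le : z^-1 <= ln z - ln y.
  have h : ln (y / z) <= - z^-1.
    have -> : y / z = 1 + - z^-1 by rewrite /z; field; rewrite gt_eqF.
    by apply: le_ln1Dx; rewrite ltrN2 invf_lt1 // /z ltrDr.
  by move: h; rewrite ln_div ?posrE //; lra.
have h : 1 + q * z^-1 <= z `^ q / y `^ q.
  have -> : z `^ q / y `^ q = expR (q * (ln z - ln y)).
    by rewrite /powR !gt_eqF // -expRB mulrBr.
  apply: le_trans (expR_ge1Dx _).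
  by rewrite lerD2l ler_wpM2l // ltW.
have -> : z `^ (1 + q) = z * z `^ q.
  by rewrite powRD ?powRr1 ?ltW // [z == 0]gt_eqF // implybT.
rewrite -(ler_pM2r zq).
have -> : q * (z * z `^ q)^-1 * z `^ q = q * z^-1 by field; rewrite !gt_eqF.
have -> : ((y `^ q)^-1 - (z `^ q)^-1) * z `^ q = z `^ q / y `^ q - 1.
  by field; rewrite !gt_eqF.
lra.
Qed.

Lemma riemannR_series_lty (R : realType) (p : R) : 1 < p ->
  (\sum_(0 <= n <oo) (riemannR p n)%:E < +oo)%E.
Proof.
move=> p1; pose q := p - 1; have q0 : 0 < q by rewrite subr_gt0.
have pE : p = 1 + q by rewrite /q addrC subrK.
(* Keeping the term -(n+1)^(-q) lets the sum telescope. The first term of the series is 1, so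
   equality holds at n = 0. *)
have bound n : \sum_(0 <= k < n.+1) riemannR p k <=
    1 + q^-1 * (1 - (n.+1%:R `^ q)^-1).
  elim: n => [|n IH].
    by rewrite big_nat1 /riemannR /= !powR1 !invr1 subrr mulr0 addr0.
  rewrite big_nat_recr //=.
  have := powR_telescope_le R q n.+1%:R q0 (ltr0Sn _ _).
  rewrite natr1 -pE -ler_pdivlMl // => h.
  apply: le_trans (lerD IH h) _.
  by rewrite !mulrBr; lra.
apply: (@le_lt_trans _ _ (1 + q^-1)%:E); last by rewrite ltry.
apply: lime_le.
  by apply: is_cvg_nneseries => n _ _; rewrite lee_fin invr_ge0 powR_ge0.
apply: nearW => n; rewrite sumEFin lee_fin.
case: n => [|n]; first by rewrite big_geq // addr_ge0 // invr_ge0 ltW.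
apply: le_trans (bound n) _.
by rewrite lerD2l ger_pMr ?invr_gt0 // lerBlDr lerDl invr_ge0 powR_ge0.
Qed.

(** * The chaos coefficients of the delta function *)

Lemma hermiteE (R : realType) (n : nat) (y : R) :
  hermite n y = (-1) ^+ n / n`!%:R * expR (y ^+ 2 / 2) * gaussn n y.
Proof. by []. Qed.

(** Since (x/sqrt s)^2/2 = x^2/(2s), the exponential in [hermite] cancels the one in [heat_kernel],
    and s^n cancels the square of s^(-n/2). *)
Lemma donsker_coef_sqr (R : realType) (x : R) (n : nat) (s : R) : 0 < s ->
  s ^+ n * donsker_coef x n s ^+ 2 =
  (gaussn n (x / Num.sqrt s)) ^+ 2 / (2 * pi * s * n`!%:R ^+ 2).
Proof.
move=> s0; rewrite /donsker_coef hermiteE /heat_kernel.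
have pi0 : 0 < 2 * pi * s :> R by rewrite !mulr_gt0 // pi_gt0.
have -> : (x / Num.sqrt s) ^+ 2 / 2 = x ^+ 2 / (2 * s).
  by rewrite expr_div_n sqr_sqrtr ?ltW //; field; rewrite gt_eqF.
rewrite expRN; set e := expR _.
have e0 : e != 0 by rewrite gt_eqF // expR_gt0.
rewrite !exprMn !exprVn sqr_sqrtr ?ltW // sqrr_sign.
have -> : (s `^ (- (n%:R / 2))) ^+ 2 = (s ^+ n)^-1.
  rewrite -powR_mulrn ?powR_ge0 // -powRrM -powR_invn ?ltW //.
  by congr (_ `^ _); field.
have f0 : n`!%:R != 0 :> R by rewrite pnatr_eq0 -lt0n fact_gt0.
have sn : s ^+ n != 0 by rewrite expf_neq0 // gt_eqF.
move: (pi_gt0 R) pi0; move: (pi : R) => P P0 pi0.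
by field; rewrite e0 f0 sn !gt_eqF.
Qed.

(** By [gaussn_le] the left side is at most 1/(pi s n! sqrt(n+1)); then pi >= 1 and s >= a. The
    bound is uniform in x and s. *)
Lemma donsker_coef_le (R : realType) (x : R) (n : nat) (a s : R) :
  0 < a -> a <= s ->
  s ^+ n * donsker_coef x n s ^+ 2 <= (a * n`!%:R * Num.sqrt n.+1%:R)^-1.
Proof.
move=> a0 as_; have s0 : 0 < s by exact: lt_le_trans as_.
rewrite donsker_coef_sqr //.
have f0 : 0 < n`!%:R :> R by rewrite ltr0n fact_gt0.
have r0 : 0 < Num.sqrt n.+1%:R :> R by rewrite sqrtr_gt0.
have p1 : 1 <= pi :> R by apply: le_trans (pi_ge2 R); rewrite ler1n.
have h := gaussn_le R n (x / Num.sqrt s).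
move: (pi : R) p1 => P p1.
have d0 : 0 < 2 * P * s * n`!%:R ^+ 2 :> R.
  apply: mulr_gt0; last exact: exprn_gt0.
  apply: mulr_gt0 => //; apply: mulr_gt0 => //; exact: lt_le_trans ltr01 p1.
rewrite ler_pdivrMr //; apply: (le_trans h).
rewrite -subr_ge0.
have -> : (a * n`!%:R * Num.sqrt n.+1%:R)^-1 * (2 * P * s * n`!%:R ^+ 2) -
    n`!%:R * 2 / Num.sqrt n.+1%:R =
    2 * n`!%:R / Num.sqrt n.+1%:R / a * (P * s - a).
  by field; rewrite !gt_eqF.
apply: mulr_ge0; first by rewrite !divr_ge0 ?mulr_ge0 // ltW.
by rewrite subr_ge0; apply: le_trans as_ _; rewrite ler_peMl // ltW.
Qed.

Lemma measurable_donsker_coef (R : realType) (x : R) (n : nat) :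
  measurable_fun (`]0, +oo[%classic : set R) (donsker_coef x n).
Proof.
have invE (t : R) : 0 <= t -> t^-1 = t `^ (-1) by move=> t0; rewrite powR_inv1.
(* Every inverse is replaced by the power with exponent -1, which agrees with it on nonnegative
   reals and is measurable on the whole line. *)
pose f (s : R) := s `^ (- (n%:R / 2)) *
  ((Num.sqrt (2 * pi * s)) `^ (-1) * expR (- (x ^+ 2 * (2 * s) `^ (-1)))) *
  hermite n (x * (Num.sqrt s) `^ (-1)).
apply: (@eq_measurable_fun _ _ _ _ _ f).
  move=> s; rewrite inE /= in_itv /= andbT => s0.
  by rewrite /f /donsker_coef /heat_kernel !invE ?sqrtr_ge0 // mulr_ge0 // ltW.
apply: measurable_funTS.
have msqrt : measurable_fun setT (@Num.sqrt R).
  by apply: continuous_measurable_fun; exact: sqrt_continuous.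
have mexp (g : R -> R) : measurable_fun setT g ->
    measurable_fun setT (fun s => expR (g s)).
  by move=> mg; apply: measurableT_comp => //; exact: measurable_expR.
have minv (g : R -> R) : measurable_fun setT g ->
    measurable_fun setT (fun s => (g s) `^ (-1)).
  by move=> mg;
    apply: (@measurableT_comp _ _ _ _ _ _ (fun t : R => t `^ (-1))) => //;
    exact: measurable_powR.
have marg : measurable_fun setT (fun s : R => x * (Num.sqrt s) `^ (-1)).
  by apply: measurable_funM => //; exact: minv.
apply: measurable_funM; first apply: measurable_funM.
- exact: measurable_powR.
- apply: measurable_funM.
    by apply: minv; apply: measurableT_comp => //; exact: measurable_funM.
  apply: mexp; apply: measurableT_comp => //.
  by apply: measurable_funM => //; apply: minv; exact: measurable_funM.
- apply: measurable_funM; first apply: measurable_funM => //.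
    apply: mexp; apply: measurable_funM => //.
    exact: measurable_funX.
  apply: (measurableT_comp _ marg).
  by apply: continuous_measurable_fun; exact: continuous_gaussn.
Qed.

(** * Iterated integration over the product measure, with the first coordinate outermost or
    innermost *)

Section tuple_measure_integral.
Context {d : measure_display} {X : measurableType d} {R : realType}.
Variable m : {finite_measure set X -> \bar R}.
Local Open Scope ereal_scope.

Lemma tuple_measureS_integral (n : nat) (f : n.+1.-tuple X -> \bar R) :
  measurable_fun setT f -> (forall t, 0 <= f t) ->
  \int[tuple_measure m n.+1]_t f t =
  \int[(m \x tuple_measure m n)]_z (f \o @tcons _ X n) z.
Proof.
move=> mf f0; rewrite -[in RHS](@preimage_setT _ _ (@tcons _ X n)).
by rewrite -(ge0_integral_pushforward (@measurable_tcons _ _ n)).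
Qed.

Lemma tuple_measureS_integral1 (n : nat) (f : n.+1.-tuple X -> \bar R) :
  measurable_fun setT f -> (forall t, 0 <= f t) ->
  \int[tuple_measure m n.+1]_t f t =
  \int[m]_x \int[tuple_measure m n]_y f (tcons (x, y)).
Proof.
move=> mf f0; rewrite tuple_measureS_integral // fubini_tonelli1 //.
  by apply: measurableT_comp => //; exact: measurable_tcons.
by move=> z; exact: f0.
Qed.

Lemma tuple_measureS_integral2 (n : nat) (f : n.+1.-tuple X -> \bar R) :
  measurable_fun setT f -> (forall t, 0 <= f t) ->
  \int[tuple_measure m n.+1]_t f t =
  \int[tuple_measure m n]_y \int[m]_x f (tcons (x, y)).
Proof.
move=> mf f0; rewrite tuple_measureS_integral // fubini_tonelli2 //.
  by apply: measurableT_comp => //; exact: measurable_tcons.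
by move=> z; exact: f0.
Qed.

End tuple_measure_integral.

(** * Integrals and null sets for products of a two-point kernel *)

Section kernel_product.
Context {d : measure_display} {X : measurableType d} {R : realType}.
Variable m : {finite_measure set X -> \bar R}.
Variable b : X -> X -> R.
Hypothesis b_ge0 : forall s y, 0 <= b s y.
Hypothesis mb : measurable_fun setT (fun z : X * X => b z.1 z.2).
Local Open Scope ereal_scope.

Definition prod_kernel (n : nat) (s : X) (t : n.-tuple X) : \bar R :=
  (\prod_(j < n) b s (tnth t j))%:E.

Definition mass_kernel (s : X) : \bar R := \int[m]_y (b s y)%:E.

Lemma measurable_kernel_comp d' (U : measurableType d') (f g : U -> X) :
  measurable_fun setT f -> measurable_fun setT g ->
  measurable_fun setT (fun u => b (f u) (g u)).
Proof.
move=> mf mg; exact: (measurableT_comp mb (measurable_fun_pair mf mg)).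
Qed.

Lemma prod_kernel_ge0 n s t : 0 <= @prod_kernel n s t.
Proof. by rewrite lee_fin prodr_ge0. Qed.

Lemma measurable_prod_kernel d' (U : measurableType d') n (f : U -> X)
    (g : U -> n.-tuple X) :
  measurable_fun setT f -> measurable_fun setT g ->
  measurable_fun setT (fun u => prod_kernel n (f u) (g u)).
Proof.
move=> mf mg; apply/measurable_EFinP; apply: measurable_prod => j _.
apply: measurable_kernel_comp => //.
exact: (measurableT_comp (measurable_tnth j)).
Qed.

Lemma prod_kernel_cons n s (z : X * n.-tuple X) :
  prod_kernel n.+1 s (tcons z) = (b s z.1)%:E * prod_kernel n s z.2.
Proof.
rewrite /prod_kernel big_ord_recl EFinM; congr (_%:E * _%:E).
by apply: eq_bigr => j _; rewrite tnthS.
Qed.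

Lemma mass_kernel_ge0 s : 0 <= mass_kernel s.
Proof. by apply: integral_ge0 => y _; rewrite lee_fin. Qed.

Lemma measurable_mass_kernel : measurable_fun setT mass_kernel.
Proof.
apply: (@measurable_fun_fubini_tonelli_F _ _ _ _ _ m
  (fun z : X * X => (b z.1 z.2)%:E)) => [|z]; last by rewrite lee_fin.
exact/measurable_EFinP.
Qed.

Lemma integral_prod_kernel n s :
  \int[tuple_measure m n]_t prod_kernel n s t = mass_kernel s ^+ n.
Proof.
elim: n => [|n IH].
  rewrite /= integral_dirac //; last exact: measurable_prod_kernel.
  by rewrite diracE in_setT mul1e /prod_kernel big_ord0.
have mpk k : measurable_fun setT (prod_kernel k s).
  by apply: (@measurable_prod_kernel _ _ k (cst s) id).
have mbs : measurable_fun setT (fun y : X => (b s y)%:E).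
  by apply/measurable_EFinP; exact: measurable_kernel_comp.
rewrite tuple_measureS_integral1 //; last exact: prod_kernel_ge0.
transitivity (\int[m]_x (mass_kernel s ^+ n * (b s x)%:E)).
  apply: eq_integral => x _.
  under eq_integral => y _ do rewrite prod_kernel_cons /=.
  rewrite ge0_integralZl //; last 3 first.
  - exact: mpk.
  - by move=> y _; exact: prod_kernel_ge0.
  - by rewrite lee_fin.
  by rewrite IH muleC.
rewrite ge0_integralZl //.
- by rewrite muleC expeS.
- by move=> y _; rewrite lee_fin.
- exact/expe_ge0/mass_kernel_ge0.
Qed.

(* For b s y = 1_{0 <= y <= s}, the integrand lives where t_i is the largest
   coordinate. *)
Lemma integral_kernel_coord (n : nat) (i : 'I_n.+1) (phi : X -> \bar R) :
  measurable_fun setT phi -> (forall s, 0 <= phi s) ->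
  \int[tuple_measure m n.+1]_t
    (phi (tnth t i) * prod_kernel n.+1 (tnth t i) t) =
  \int[m]_s (phi s * (b s s)%:E * mass_kernel s ^+ n).
Proof.
move=> mphi phi0.
have mint k (j : 'I_k) (psi : X -> \bar R) : measurable_fun setT psi ->
    measurable_fun setT (fun t : k.-tuple X =>
      psi (tnth t j) * prod_kernel k (tnth t j) t).
  move=> mpsi; apply: emeasurable_funM.
    exact: (measurableT_comp mpsi (measurable_tnth j)).
  by apply: measurable_prod_kernel => //; exact: measurable_tnth.
(* For the first coordinate, integrated outermost, the factor j = 0 gives b(s,s) and the k others
   integrate to [mass_kernel s ^+ k]. *)
have base k (psi : X -> \bar R) : measurable_fun setT psi ->
    (forall s, 0 <= psi s) ->
    \int[tuple_measure m k.+1]_t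
      (psi (tnth t ord0) * prod_kernel k.+1 (tnth t ord0) t) =
    \int[m]_s (psi s * (b s s)%:E * mass_kernel s ^+ k).
  move=> mpsi psi0.
  rewrite tuple_measureS_integral1; [|exact: mint|]; last first.
    by move=> t; rewrite mule_ge0 // prod_kernel_ge0.
  apply: eq_integral => s _.
  have -> : (fun y => psi (tnth (tcons (s, y)) ord0) *
      prod_kernel k.+1 (tnth (tcons (s, y)) ord0) (tcons (s, y))) =
      (fun y => psi s * (b s s)%:E * prod_kernel k s y).
    by apply/funext => y; rewrite prod_kernel_cons /= muleA.
  rewrite ge0_integralZl ?integral_prod_kernel //.
  - exact: (@measurable_prod_kernel _ _ k (cst s) id).
  - by move=> y _; exact: prod_kernel_ge0.
  - by rewrite mule_ge0 // lee_fin.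
elim: n i phi mphi phi0 => [|n IH] i phi mphi phi0.
  by rewrite ord1; exact: base.
have [k Ek|->] := unliftP ord0 i; last exact: base.
rewrite tuple_measureS_integral2; [|exact: mint|]; last first.
  by move=> t; rewrite mule_ge0 // prod_kernel_ge0.
(* For a later coordinate, the first variable occurs only in the factor b(t_i, x). Integrating it
   innermost produces one [mass_kernel], which is absorbed into [phi] before the induction
   hypothesis is applied. *)
transitivity (\int[tuple_measure m n.+1]_y
    ((phi \* mass_kernel) (tnth y k) * prod_kernel n.+1 (tnth y k) y)).
  apply: eq_integral => y _.
  have -> : (fun x => phi (tnth (tcons (x, y)) i) *
      prod_kernel n.+2 (tnth (tcons (x, y)) i) (tcons (x, y))) =
      (fun x => phi (tnth y k) * prod_kernel n.+1 (tnth y k) y *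
         (b (tnth y k) x)%:E).
    apply/funext => x; rewrite Ek tnthS prod_kernel_cons /=.
    by rewrite -muleA; congr (_ * _); rewrite muleC.
  rewrite ge0_integralZl //.
  - by rewrite /= /mass_kernel -!muleA; congr (_ * _); rewrite muleC.
  - by apply/measurable_EFinP; exact: measurable_kernel_comp.
  - by move=> x _; rewrite lee_fin.
  - by rewrite mule_ge0 // prod_kernel_ge0.
rewrite (IH k (phi \* mass_kernel)).
- apply: eq_integral => s _.
  rewrite expeS /= -!muleA; congr (_ * _).
  by rewrite muleCA.
- by apply: emeasurable_funM => //; exact: measurable_mass_kernel.
- by move=> s; rewrite mule_ge0 // mass_kernel_ge0.
Qed.

(** Induction on n, removing the first coordinate. If i is not first, that coordinate is integrated
    outermost and the pair survives in the rest; if i is first, it is integrated innermost over a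
    null section of D. As i < j, the index j is never first. *)
Lemma tuple_measure_pair_null (D : set (X * X)) (n : nat) (i j : 'I_n) :
  measurable D -> (forall y, m [set x | D (x, y)] = 0) -> (i < j)%N ->
  tuple_measure m n [set t | D (tnth t i, tnth t j)] = 0.
Proof.
move=> mD D0; elim: n i j => [[]//|n IH] i j ij.
have mE k (p q : 'I_k) :
    measurable ([set t | D (tnth t p, tnth t q)] : set (k.-tuple X)).
  rewrite -[X in measurable X]setTI.
  exact: (measurable_fun_pair (measurable_tnth p) (measurable_tnth q)).
have mI k (p q : 'I_k) : measurable_fun setT (fun t : k.-tuple X =>
    (\1_[set t : k.-tuple X | D (tnth t p, tnth t q)] t)%:E : \bar R).
  by apply/measurable_EFinP; apply: measurable_indic; exact: mE.
have j0 : ord0 != j by apply/eqP => E; rewrite -E in ij.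
have [k Ek] : exists k, j = lift ord0 k.
  by have [k ->|E] := unliftP ord0 j; [exists k | rewrite E in j0].
(* The measure is written as the integral of an indicator so that the iterated integrals apply. *)
rewrite -[LHS](_ : \int[tuple_measure m n.+1]_t
   (\1_[set t : n.+1.-tuple X | D (tnth t i, tnth t j)] t)%:E = _); last first.
  by rewrite integral_indic ?setIT //; exact: mE.
have [l El|Ei] := unliftP ord0 i.
- rewrite tuple_measureS_integral1 //.
  apply: integral0_eq => x _.
  rewrite (_ : (fun y => _) = (fun y : n.-tuple X =>
    (\1_[set t : n.-tuple X | D (tnth t l, tnth t k)] y)%:E)); last first.
    apply/funext => y; rewrite El Ek !indicE.
    congr ((nat_of_bool _)%:R%:E); apply/idP/idP; rewrite !inE /= !tnthS //.
  rewrite (integral_indic _ measurableT (mE _ _ _)) setIT; apply: IH.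
  by move: ij; rewrite El Ek !lift0.
- rewrite tuple_measureS_integral2 //.
  apply: integral0_eq => y _.
  rewrite (_ : (fun x => _) = (fun x : X =>
    (\1_[set x : X | D (x, tnth y k)] x)%:E)); last first.
    apply/funext => x; rewrite Ei Ek !indicE.
    congr ((nat_of_bool _)%:R%:E); apply/idP/idP; rewrite !inE /= !tnthS //.
  rewrite integral_indic ?setIT //; first exact: D0.
  rewrite -[X in measurable X]setTI.
  have mpair : measurable_fun setT (fun x : X => (x, tnth y k)).
    by apply: measurable_fun_pair.
  exact: mpair.
Qed.
End kernel_product.

(** * Symmetrization and the norm of a sum of coordinate kernels *)

(** Composing with a transposition shows that the sum over s of h(s i) is the same for every i;
    summing over i and exchanging the sums gives the full sum of h for each s. Symmetrization thus
    reduces to choosing which variable is the integration time. *)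
Lemma average_perm (R : numFieldType) (n : nat) (h : 'I_n.+1 -> R) :
  n.+1`!%:R^-1 * \sum_(s : 'S_n.+1) h (s ord0) = n.+1%:R^-1 * \sum_i h i.
Proof.
have E (i : 'I_n.+1) :
    \sum_(s : 'S_n.+1) h (s i) = \sum_(s : 'S_n.+1) h (s ord0).
  rewrite (reindex_inj (mulgI (tperm ord0 i))) /=.
  by apply: eq_bigr => s _; rewrite permM tpermR.
have S : n.+1%:R * \sum_(s : 'S_n.+1) h (s ord0) = n.+1`!%:R * \sum_i h i.
  transitivity (\sum_(i < n.+1) \sum_(s : 'S_n.+1) h (s i)).
    rewrite [RHS](eq_bigr (fun=> \sum_(s : 'S_n.+1) h (s ord0))) //.
    by rewrite big_const_ord iter_addr addr0 mulr_natl.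
  rewrite exchange_big /= [LHS](eq_bigr (fun=> \sum_i h i)).
    by rewrite sumr_const card_Sn mulr_natl.
  by move=> s _; rewrite [RHS](reindex_inj (@perm_inj _ s)).
have f0 : n.+1`!%:R != 0 :> R by rewrite pnatr_eq0 -lt0n fact_gt0.
have n0 : n.+1%:R != 0 :> R by rewrite pnatr_eq0.
apply: (mulfI f0); rewrite mulVKf //.
by apply: (mulfI n0); rewrite S [RHS]mulrCA mulVKf.
Qed.

Section kernel_L2.
Context {d : measure_display} {X : measurableType d} {R : realType}.
Variable m : {finite_measure set X -> \bar R}.
Variable b : X -> X -> R.
Hypothesis b_ge0 : forall s y, 0 <= b s y.
Hypothesis mb : measurable_fun setT (fun z : X * X => b z.1 z.2).
Hypothesis b_idem : forall s y, b s y ^+ 2 = b s y.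
(* Ties are negligible; this makes distinct coordinate kernels orthogonal. *)
Hypothesis b_null : forall y, m [set x | b x y * b y x != 0] = 0%E.

(** For b(s,y) = 1_[0,s](y), this is v(t_i) when all coordinates lie in [0, t_i] and 0 otherwise:
    the unsymmetrized kernel with t_i as integration time. *)
Definition coord_kernel (v : X -> R) (n : nat) (i : 'I_n)
    (t : n.-tuple X) : R :=
  v (tnth t i) * \prod_(j < n) b (tnth t i) (tnth t j).

Lemma measurable_coord_kernel v n (i : 'I_n) : measurable_fun setT v ->
  measurable_fun setT (coord_kernel v n i).
Proof.
move=> mv; apply: measurable_funM.
  exact: (measurableT_comp mv (measurable_tnth i)).
apply: measurable_prod => j _.
by apply: (measurable_kernel_comp _ mb); exact: measurable_tnth.
Qed.

(** Kernel i contains the factor b(t_i,t_j) and kernel j the factor b(t_j,t_i). *)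
Lemma coord_kernel_orthogonal v n (i j : 'I_n) (t : n.-tuple X) :
  b (tnth t i) (tnth t j) * b (tnth t j) (tnth t i) = 0 ->
  coord_kernel v n i t * coord_kernel v n j t = 0.
Proof.
move/eqP; rewrite mulf_eq0 /coord_kernel (bigD1 j) //= => /orP[/eqP->|/eqP z].
  by rewrite mul0r mulr0 mul0r.
by rewrite [\prod_(_ < _) b (tnth t j) _](bigD1 i) //= z mul0r !mulr0.
Qed.

(** Off the null set of ties the cross terms vanish, so the square of the sum is the sum of the
    squares. As b is idempotent, squaring a coordinate kernel only squares v, and by
    [integral_kernel_coord] all n+1 squares have the same integral. *)
Lemma integral_sum_coord_kernel_sqr v n : measurable_fun setT v ->
  (\int[tuple_measure m n.+1]_t ((\sum_i coord_kernel v n.+1 i t) ^+ 2)%:E =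
   n.+1%:R%:E *
   \int[m]_s ((v s ^+ 2)%:E * (b s s)%:E * mass_kernel m b s ^+ n))%E.
Proof.
move=> mv.
pose D := [set z : X * X | b z.1 z.2 * b z.2 z.1 != 0].
have mD : measurable D.
  rewrite -[X in measurable X]setTI.
  have mbb : measurable_fun setT (fun z : X * X => b z.1 z.2 * b z.2 z.1).
    apply: measurable_funM => //.
    by apply: (@measurable_kernel_comp _ _ _ b mb _ (X * X)%type snd fst).
  have := mbb measurableT (~` [set 0]) (measurableC (measurable_set1 0)).
  congr (measurable (_ `&` _)).
  by apply/seteqP; split => z /= /eqP.
set mu := tuple_measure m n.+1.
have tie_free : {ae mu, forall t, forall i j : 'I_n.+1, (i < j)%N ->
    b (tnth t i) (tnth t j) * b (tnth t j) (tnth t i) = 0}.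
  apply: filter_forall => i; apply: filter_forall => j.
  have [ij|ji] := ltnP i j; last by apply: nearW.
  exists [set t | D (tnth t i, tnth t j)]; split.
  - rewrite -[X in measurable X]setTI.
    exact: (measurable_fun_pair (measurable_tnth i) (measurable_tnth j)).
  - by apply: (@tuple_measure_pair_null _ _ _ m D n.+1 i j mD).
  - move=> t /= /not_implyP[_ /eqP //].
have mw i : measurable_fun setT (coord_kernel v n.+1 i).
  exact: measurable_coord_kernel.
have sqr_sum : {ae mu, forall t, (\sum_i coord_kernel v n.+1 i t) ^+ 2 =
    \sum_i (coord_kernel v n.+1 i t) ^+ 2}.
  apply: filterS tie_free => t tie.
  rewrite expr2 big_distrlr /=; apply: eq_bigr => i _.
  rewrite (bigD1 i) //= big1 ?addr0 ?expr2 // => j ji.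
  apply: coord_kernel_orthogonal.
  have [/tie //|lt_ji|/val_inj E] := ltngtP i j.
    by rewrite mulrC; exact: tie.
  by rewrite E eqxx in ji.
transitivity (\int[mu]_t \sum_i ((coord_kernel v n.+1 i t) ^+ 2)%:E)%E.
  apply: ge0_ae_eq_integral => //.
  - apply/measurable_EFinP; apply: measurable_funX; exact: measurable_sum.
  - apply: emeasurable_sum => i; apply/measurable_EFinP.
    exact: measurable_funX.
  - by move=> t _; rewrite lee_fin sqr_ge0.
  - by move=> t _; apply: sume_ge0 => i _; rewrite lee_fin sqr_ge0.
  - by apply: filterS sqr_sum => t E _; rewrite E sumEFin.
rewrite ge0_integral_sum //; last 2 first.
- by move=> i; apply/measurable_EFinP; exact: measurable_funX.
- by move=> i t _; rewrite lee_fin sqr_ge0.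
under eq_bigr => i _.
  rewrite (_ : (fun t => _) = (fun t =>
      ((v (tnth t i) ^+ 2)%:E * prod_kernel b n.+1 (tnth t i) t)%E));
    last first.
    apply/funext => t; rewrite /coord_kernel /prod_kernel exprMn -EFinM.
    by congr (_ * _)%:E; rewrite -prodrXl; apply: eq_bigr => j _.
  rewrite (integral_kernel_coord m b b_ge0 mb n i (fun s => (v s ^+ 2)%:E)).
  - over.
  - by apply/measurable_EFinP; exact: measurable_funX.
  - by move=> s; rewrite lee_fin sqr_ge0.
by rewrite big_const_ord iter_addr addr0 mule_natl.
Qed.
End kernel_L2.

(** * Square-integrability in terms of integrals of squares *)

Lemma Lnorm2_sqr {d} {X : measurableType d} {R : realType}
    (mu : {measure set X -> \bar R}) (f : X -> R) :
  ('N[mu]_2%:E[EFin \o f] ^+ 2 = \int[mu]_t ((f t) ^+ 2)%:E)%E.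
Proof.
transitivity ('N[mu]_2%:E[EFin \o f] `^ 2)%E.
  have := Lnorm_ge0 mu 2%:E (EFin \o f).
  case: ('N[mu]_2%:E[EFin \o f])%E => [r|_|//].
  - by rewrite lee_fin => r0; rewrite poweR_EFin powR_mulrn.
  - by rewrite poweRyr.
rewrite poweR_Lnorm //; apply: eq_integral => t _ /=.
by rewrite powR_mulrn // real_normK // num_real.
Qed.

Lemma Lfun2P {d} {X : measurableType d} {R : realType}
    (mu : {measure set X -> \bar R}) (f : X -> R) :
  measurable_fun setT f -> (\int[mu]_t ((f t) ^+ 2)%:E < +oo)%E ->
  f \in Lfun mu 2%:E.
Proof.
move=> mf; rewrite -Lnorm2_sqr => fin.
rewrite inE; apply/andP; split; apply: mem_set => //=.
rewrite /finite_norm; have := Lnorm_ge0 mu 2%:E (EFin \o f); move: fin.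
by case: ('N[mu]_2%:E[EFin \o f])%E => [r _ _||//]; rewrite ?ltry.
Qed.

(** * The kernel 1_[0,s](y) under Lebesgue measure on [0,T] *)

Definition below {R : realType} (s y : R) : R := \1_(`[0, s]%classic) y.

Lemma belowE {R : realType} (s y : R) : below s y = ((0 <= y <= s)%R)%:R.
Proof. by rewrite /below indicE mem_setE in_itv. Qed.

Lemma below_ge0 {R : realType} (s y : R) : 0 <= below s y.
Proof. by rewrite belowE ler0n. Qed.

Lemma below_idem {R : realType} (s y : R) : below s y ^+ 2 = below s y.
Proof. by rewrite belowE; case: (_ <= _ <= _); rewrite ?expr1n ?expr0n. Qed.

Lemma measurable_below (R : realType) :
  measurable_fun setT (fun z : measurableTypeR R * measurableTypeR R =>
    below z.1 z.2).
Proof.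
have -> : (fun z : measurableTypeR R * measurableTypeR R => below z.1 z.2) =
    \1_([set z : measurableTypeR R * measurableTypeR R | 0 <= (z.2 : R)] `&`
        [set z | (z.2 : R) <= z.1]).
  apply/funext => z; rewrite belowE indicE; congr (nat_of_bool _)%:R.
  apply/idP/idP => [/andP[y0 ys]|/set_mem[/= y0 ys]]; last exact/andP.
  exact: mem_set.
apply: measurable_indic; apply: measurableI; rewrite -[X in measurable X]setTI.
- by apply: (measurable_fun_ler (f := cst 0) (g := snd)).
- by apply: (measurable_fun_ler (f := snd) (g := fst)).
Qed.

Lemma itv_measure_pt (R : realType) (T y : R) : itv_measure T [set y] = 0%E.
Proof.
apply/eqP; rewrite -measure_le0 -[leRHS](@lebesgue_measure_set1 R y).
apply: le_measure; [apply: mem_set | exact: mem_set | exact: subIsetl].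
by apply: measurableI => //; exact: measurable_itv.
Qed.

Lemma itv_measureT_le (R : realType) (T : R) : 0 <= T ->
  (itv_measure T setT <= T%:E)%E.
Proof.
move=> T0; rewrite /itv_measure /mrestr setTI lebesgue_measure_itv /= lte_fin.
by case: ltP => // _; rewrite -EFinB subr0.
Qed.

(** Two nonzero factors force x <= y and y <= x, and points are null. The set is computed exactly,
    as {y} or empty according to the sign of y. *)
Lemma below_tie_null (R : realType) (T y : R) :
  itv_measure T [set x | below x y * below y x != 0] = 0%E.
Proof.
have sub : [set x | below x y * below y x != 0] `<=` [set y].
  move=> x /=; rewrite !belowE mulf_eq0 negb_or => /andP[].
  rewrite !pnatr_eq0 !eqb0 !negbK => /andP[_ yx] /andP[_ xy].
  by apply/eqP; rewrite eq_le xy.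
have -> : [set x | below x y * below y x != 0] =
    (if 0 <= y then [set y] else set0).
  apply/seteqP; split => x.
    move=> h; have xy := sub x h; rewrite /= in xy; move: h; rewrite /= xy.
    by rewrite !belowE; case: (leP 0 y) => //=; rewrite mul0r eqxx.
  case: ifP => // y0 ->; rewrite /= !belowE y0 lexx mulr1; exact: oner_neq0.
by case: ifP => _; rewrite ?measure0 ?itv_measure_pt.
Qed.

Lemma mass_below_le (R : realType) (T s : R) : 0 <= s ->
  (mass_kernel (itv_measure T) below s <= s%:E)%E.
Proof.
move=> s0; rewrite /mass_kernel integral_indic // setIT.
apply: (@le_trans _ _ (@lebesgue_measure R `[0, s]%classic)).
  apply: le_measure; [apply: mem_set | exact: mem_set | exact: subIsetl].
  by apply: measurableI; exact: measurable_itv.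
rewrite lebesgue_measure_itv /= lte_fin.
by case: ltP => // _; rewrite -EFinB subr0.
Qed.

(** * The kernels of the Skorohod integral and their norms *)

Definition cut_coef {R : realType} (a T x : R) (n : nat) (s : R) : R :=
  \1_(`[a, T]%classic) s * donsker_coef x n s.

Lemma measurable_cut_coef (R : realType) (a T x : R) (n : nat) :
  0 < a -> measurable_fun setT (cut_coef a T x n).
Proof.
move=> a0.
rewrite (_ : cut_coef a T x n = (donsker_coef x n) \_ (`[a, T]%classic)).
  apply/(measurable_restrictT _ (measurable_itv _)).
  apply: (@measurable_funS _ _ _ _ (`]0, +oo[%classic : set R)) => //;
    last exact: measurable_donsker_coef.
  move=> s /=; rewrite !in_itv /= => /andP[as_ _].
  by rewrite (lt_le_trans a0 as_).
apply/funext => s; rewrite /cut_coef patchE indicE.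
by case: ifP; rewrite ?mul1r ?mul0r.
Qed.

(** A permutation s matters only through s(0), the index of the integration time: the remaining
    factors run over all other indices. [average_perm] then turns the average over permutations into
    one over indices. *)
Lemma divergence_donskerE (R : realType) (a T x : R) (n : nat)
    (t : n.+1.-tuple (measurableTypeR R)) : 0 < a ->
  divergence_kernel (fun s k u => \1_(`[a, T]%classic) s *
    donsker_kernel x s u) t =
  n.+1%:R^-1 * \sum_i coord_kernel below (cut_coef a T x n) n.+1 i t.
Proof.
move=> a0; rewrite -average_perm /= /symmetrize; congr (_ * _).
apply: eq_bigr => s _.
rewrite /coord_kernel /cut_coef /donsker_kernel mulrA.
set u := thead _; have -> : u = tnth t (s ord0).
  by rewrite /u /thead tnth_mktuple.
rewrite (reindex_inj (@perm_inj _ s)) /= big_ord_recl.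
have [/andP[as_ sT]|out] := boolP (a <= tnth t (s ord0) <= T); last first.
  by rewrite indicE mem_setE in_itv /= (negbTE out) !mul0r.
(* The coordinate kernel has one extra factor, at j = s(0); it equals 1 because this coordinate is
   at least a > 0. *)
rewrite belowE lexx (le_trans (ltW a0) as_) /= mul1r; congr (_ * _).
apply: eq_bigr => i _; rewrite /below tnth_behead tnth_mktuple.
congr (\1_(_) (tnth t (s _))); apply: val_inj.
by rewrite /= inordK // ltnS.
Qed.

Lemma lee_expe {R : realDomainType} (x y : \bar R) (n : nat) :
  (0 <= x -> x <= y -> x ^+ n <= y ^+ n)%E.
Proof.
move=> x0 xy; elim: n => [|n IH]; first by rewrite !expe0.
by rewrite !expeS lee_pmul // expe_ge0.
Qed.

Lemma measurable_expe {d} {X : measurableType d} {R : realType}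
    (f : X -> \bar R) (n : nat) :
  measurable_fun setT f -> measurable_fun setT (fun t => f t ^+ n)%E.
Proof.
move=> mf; elim: n => [|n IH]; first exact: measurable_cst.
rewrite (_ : (fun t => _) = (fun t => f t * f t ^+ n)%E).
  exact: emeasurable_funM.
by apply/funext => t; rewrite expeS.
Qed.

(** The prefactor (n+1)^(-2) meets n+1 equal integrals, each at most T/(a n! sqrt(n+1)); the
    remaining 1/(n+1) turns n! into (n+1)!. *)
Lemma divergence_donsker_L2 (R : realType) (a T x : R) (n : nat) :
  0 < a -> a < T ->
  (\int[cube_measure T n.+1]_t
    ((divergence_kernel (fun s k u => \1_(`[a, T]%classic) s *
        donsker_kernel x s u) t) ^+ 2)%:E <=
  (T / (a * n.+1`!%:R * Num.sqrt n.+1%:R))%:E)%E.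
Proof.
move=> a0 aT.
pose m : {finite_measure set (measurableTypeR R) -> \bar R} := itv_measure T.
pose v := cut_coef a T x n.
have mv : measurable_fun setT v by exact: measurable_cut_coef.
(* The bound of [donsker_coef_le] on s^n a_n(s)^2. *)
pose K := (a * n`!%:R * Num.sqrt n.+1%:R)^-1.
have K0 : 0 <= K by rewrite invr_ge0 !mulr_ge0 // ltW.
have n0 : n.+1%:R != 0 :> R by rewrite pnatr_eq0.
under eq_integral => t _ do rewrite divergence_donskerE // exprMn EFinM.
rewrite ge0_integralZl_EFin //; last 2 first.
- by move=> t _; rewrite lee_fin sqr_ge0.
- apply/measurable_EFinP; apply: measurable_funX; apply: measurable_sum => i.
  by apply: measurable_coord_kernel => //; exact: measurable_below.
have -> := integral_sum_coord_kernel_sqr m below below_ge0 (measurable_below R)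
  below_idem (below_tie_null R T) v n mv.
have bound : (\int[m]_s ((v s ^+ 2)%:E * (below s s)%:E *
    mass_kernel m below s ^+ n) <= (K * T)%:E)%E.
  apply: (@le_trans _ _ (\int[m]_s K%:E)%E).
    apply: ge0_le_integral => //.
    - move=> s _; rewrite !mule_ge0 ?lee_fin ?sqr_ge0 ?below_ge0 //.
      by apply: expe_ge0; apply: mass_kernel_ge0 => *; exact: below_ge0.
    - apply: emeasurable_funM; first apply: emeasurable_funM.
      + by apply/measurable_EFinP; exact: measurable_funX.
      + apply/measurable_EFinP.
        by apply: (@measurable_kernel_comp _ (measurableTypeR R) R below
          (measurable_below R) _ (measurableTypeR R) id id).
      + apply: measurable_expe; apply: measurable_mass_kernel.
          by move=> *; exact: below_ge0.
        exact: measurable_below.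
    move=> s _; rewrite /v /cut_coef indicE mem_setE in_itv /=.
    have [/andP[as_ sT]|_] := boolP (a <= s <= T); last first.
      by rewrite mul0r expr0n /= !mul0e lee_fin.
    have s0 : 0 <= s by rewrite (le_trans (ltW a0)).
    rewrite mul1r belowE s0 lexx mule1.
    (* The mass of [0,s] is at most s, so its n-th power supplies the factor s^n in
       [donsker_coef_le]. *)
    apply: (@le_trans _ _ ((donsker_coef x n s ^+ 2)%:E * s%:E ^+ n)%E).
      apply: lee_wpmul2l; first by rewrite lee_fin sqr_ge0.
      apply: lee_expe; last exact: mass_below_le.
      by apply: mass_kernel_ge0 => *; exact: below_ge0.
    by rewrite -EFin_expe -EFinM lee_fin mulrC donsker_coef_le.
  rewrite integral_cst // EFinM; apply: lee_wpmul2l; first by rewrite lee_fin.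
  exact: (itv_measureT_le R T (ltW (lt_trans a0 aT))).
apply: (@le_trans _ _ (((n.+1%:R^-1) ^+ 2)%:E * (n.+1%:R%:E * (K * T)%:E))%E).
  apply: lee_wpmul2l; first by rewrite lee_fin sqr_ge0.
  by apply: lee_wpmul2l => //; rewrite lee_fin.
rewrite -!EFinM lee_fin /K factS natrM le_eqVlt; apply/orP; left; apply/eqP.
have f0 : n`!%:R != 0 :> R by rewrite pnatr_eq0 -lt0n fact_gt0.
have r0 : Num.sqrt n.+1%:R != 0 :> R by rewrite gt_eqF // sqrtr_gt0.
by field; rewrite f0 r0 nat1r n0 gt_eqF.
Qed.

(** * Symmetry of the kernels, comparison series and conclusion *)

Lemma symmetrize_symmetric (R : realType) (n : nat) (f : chaos_kernel R n) :
  symmetric_kernel (symmetrize f).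
Proof.
move=> s t; rewrite /symmetrize; congr (_ * _).
rewrite (reindex_inj (mulIg s^-1%g)) /=; apply: eq_bigr => r _; congr (f _).
apply: eq_from_tnth => i; rewrite !tnth_mktuple.
by congr (tnth t _); rewrite permM permKV.
Qed.

(** The base of [riemannR] at index n+1 is n+2, so this amounts to sqrt(n+2) <= 2 sqrt(n+1). *)
Lemma powR_half_shift (R : realType) (alpha : R) (n : nat) :
  (1 + n.+1%:R) `^ (- alpha) / Num.sqrt n.+1%:R <=
  2 * riemannR (alpha + 1 / 2) n.+1.
Proof.
have y0 : 0 < (n.+2%:R : R) by [].
rewrite nat1r /riemannR powRN powRD ?[n.+2%:R == 0]gt_eqF ?implybT //.
rewrite div1r powR12_sqrt // invfM mulrCA; apply: ler_wpM2l.
  by rewrite invr_ge0 powR_ge0.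
have s1 : 0 < Num.sqrt n.+1%:R :> R by rewrite sqrtr_gt0.
have s2 : 0 < Num.sqrt n.+2%:R :> R by rewrite sqrtr_gt0.
rewrite ler_pdivlMr // mulrC ler_pdivrMr //.
rewrite -[2](@ger0_norm R) // -sqrtr_sqr -sqrtrM ?sqr_ge0 // ler_wsqrtr //.
by rewrite -natrX -natrM ler_nat; lia.
Qed.

Theorem proposition5 (R : realType) (d : measure_display)
    (Omega : measurableType d) (P : probability Omega R) (a T : R)
    (B : R -> Omega -> R)
    (I : forall n : nat, chaos_kernel R n -> Omega -> R)
    (a_gt0 : 0 < a) (a_lt_T : a < T)
    (B_wiener : wiener_process P T B)
    (I_integral : multiple_wiener_integral P T B I)
    (x alpha : R) (alpha_gt : 1 / 2 < alpha) :
  watanabe_sobolev P T I (- alpha) (donsker_integral a T x I).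
Proof.
pose u := fun s n (t : n.-tuple (measurableTypeR R)) =>
  \1_(`[a, T]%classic) s * donsker_kernel x s t.
have L2le n := divergence_donsker_L2 R a T x n a_gt0 a_lt_T.
have T0 : 0 < T by exact: lt_trans a_lt_T.
(* The functional is by definition the chaos series of these kernels, so the almost sure equality is
   immediate. *)
exists (divergence_kernel u); split.
- move=> [|n].
    apply: Lfun2P => //=; under eq_integral do rewrite expr0n /=.
    by rewrite integral0.
  apply: Lfun2P; last by apply: (le_lt_trans (L2le n)); rewrite ltry.
  rewrite (_ : @divergence_kernel R u n.+1 = fun t =>
    n.+1%:R^-1 * \sum_i coord_kernel below (cut_coef a T x n) n.+1 i t).
    apply: measurable_funM => //; apply: measurable_sum => i.
    apply: measurable_coord_kernel; first exact: measurable_below.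
    exact: measurable_cut_coef.
  by apply/funext => t; exact: divergence_donskerE.
- by move=> [|n]; [move=> s t | exact: symmetrize_symmetric].
- by move=> n; apply: nearW.
(* Here alpha > 1/2 enters: the comparison series has exponent above 1. *)
have p1 : 1 < alpha + 1 / 2 by lra.
(* T/a comes from the norm bound and 2 from [powR_half_shift]. *)
pose C := 2 * (T / a).
have C0 : 0 <= C by rewrite mulr_ge0 // divr_ge0 // ltW.
apply: (@le_lt_trans _ _
    (\sum_(0 <= n <oo) (C%:E * (riemannR (alpha + 1 / 2) n)%:E))%E); last first.
  rewrite nneseriesZl; last by move=> n _; rewrite lee_fin invr_ge0 powR_ge0.
  by apply: lte_mul_pinfty => //; exact: riemannR_series_lty.
have w0 n : 0 <= (1 + n%:R) `^ (- alpha) * n`!%:R :> R.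
  by rewrite mulr_ge0 // powR_ge0.
apply: lee_nneseries => [n _ _|n _].
  by rewrite mule_ge0 ?lee_fin // expe_ge0 // Lnorm_ge0.
(* The divergence has no component of order 0, so that term vanishes; at order n+1 the weight (n+1)!
   cancels against the norm bound. *)
rewrite Lnorm2_sqr; case: n => [|n].
  rewrite (_ : (\int[_]_t _)%E = 0%E).
    by rewrite mule0 -EFinM lee_fin mulr_ge0 // invr_ge0 powR_ge0.
  by apply: integral0_eq => t _; rewrite expr0n.
apply: (@le_trans _ _ (((1 + n.+1%:R) `^ (- alpha) * n.+1`!%:R)%:E *
   (T / (a * n.+1`!%:R * Num.sqrt n.+1%:R))%:E)%E).
  by apply: lee_wpmul2l; [rewrite lee_fin | exact: L2le].
rewrite -!EFinM lee_fin.
have f0 : n.+1`!%:R != 0 :> R by rewrite pnatr_eq0 -lt0n fact_gt0.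
have r0 : Num.sqrt n.+1%:R != 0 :> R by rewrite gt_eqF // sqrtr_gt0.
rewrite [leLHS](_ : _ = T / a *
  ((1 + n.+1%:R) `^ (- alpha) / Num.sqrt n.+1%:R)).
  rewrite /C -[leRHS]mulrA [leRHS]mulrCA; apply: ler_wpM2l.
    by rewrite divr_ge0 // ltW.
  exact: powR_half_shift.
by field; rewrite f0 r0 gt_eqF.
Qed.
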